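(* Let $\mathbb{E}(3,3)$ be the set of partitions in $\mathbb{C}(3,3)$ having no odd parts, and let $\mathbb{F}(3,3)$ be the set of pairs $(\pi,\zeta)$ of partitions such that $\pi\in\mathbb{E}(3,3)$ and $\zeta$ is a partition into distinct odd parts, each at least $2N_2(\pi)+1$ (the empty partition allowed). There is a bijection $\Phi\colon\mathbb{F}(3,3)\to\mathbb{C}(3,3)$ such that for every $(\pi,\zeta)\in\mathbb{F}(3,3)$, the partition $\omega=\Phi(\pi,\zeta)$ satisfies $|\omega|=|\pi|+|\zeta|$ and $\ell(\omega)=\ell(\pi)+\ell(\zeta)$.
   Context: A partition $\pi=(\pi_1,\dots,\pi_\ell)$ is a finite non-increasing sequence of positive integers; $\ell(\pi)$ is its number of parts and $|\pi|$ its sum. Göllnitz–Gordon marking: $GG(\pi)$ assigns a positive integer (mark) to each part, processing the parts from smallest to largest ($\pi_\ell,\dots,\pi_1$); $\pi_i$ receives the smallest positive integer different from the marks of all parts $\pi_g$ with $g>i$ and $\pi_i-\pi_g\le 2$, where $\pi_i-\pi_g<2$ is required when $\pi_i$ is odd. $N_2(\pi)$ is the number of parts of $\pi$ receiving mark $2$. $\mathbb{C}(3,3)$: the set of partitions $\pi=(\pi_1,\dots,\pi_\ell)$ such that (i) no odd part is repeated; (ii) $\pi_i\ge\pi_{i+2}+2$ for $1\le i\le\ell-2$, with strict inequality if $\pi_i$ is even; (iii) at most $2$ parts are $\le 2$. *)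

(* Defs.v *)
From mathcomp Require Import all_boot.
Set Implicit Arguments. Unset Strict Implicit. Unset Printing Implicit Defensive.

Definition is_partition (s : seq nat) : bool :=
  sorted geq s && all (fun x => 0 < x) s.

Definition mex (s : seq nat) : nat :=
  head 0 [seq n <- iota 1 (size s).+1 | n \notin s].

(* does the previously marked part q (q <= p) constrain the mark of p? *)
Definition gg_conflict (p q : nat) : bool :=
  (p - q <= 2) && (odd p ==> (p - q < 2)).

(* Process parts in non-decreasing order; [prev] holds (part, mark) pairs of
   the already processed (smaller-or-equal, later-indexed) parts. *)
Fixpoint gg_aux (prev : seq (nat * nat)) (r : seq nat) : seq nat :=
  match r with
  | [::] => [::]
  | p :: r' =>
      let m := mex [seq pm.2 | pm <- prev & gg_conflict p pm.1] in
      m :: gg_aux ((p, m) :: prev) r'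
  end.

(* Göllnitz–Gordon marks, listed for the parts from smallest to largest
   (pi_l, ..., pi_1). *)
Definition GG (pi : seq nat) : seq nat := gg_aux [::] (rev pi).

Definition N2 (pi : seq nat) : nat := count (pred1 2) (GG pi).

Definition inC33 (pi : seq nat) : bool :=
  [&& is_partition pi,
      all (fun x => odd x ==> (count (pred1 x) pi <= 1)) pi,
      all (fun i => if odd (nth 0 pi i)
                    then nth 0 pi (i.+2) + 2 <= nth 0 pi i
                    else nth 0 pi (i.+2) + 2 < nth 0 pi i)
          (iota 0 (size pi - 2)) &
      count (fun x => x <= 2) pi <= 2].

Definition inE33 (pi : seq nat) : bool := inC33 pi && all (fun x => ~~ odd x) pi.

Definition inF33 (pi zeta : seq nat) : bool :=
  [&& inE33 pi, is_partition zeta, uniq zeta, all odd zeta &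
      all (fun x => (N2 pi).*2.+1 <= x) zeta].

(* Main.v *)
Require Import Defs.
From mathcomp Require Import all_boot.
From mathcomp Require Import zify.
Set Implicit Arguments. Unset Strict Implicit. Unset Printing Implicit Defensive.

(* Write a partition by its multiplicities f_1, f_2, f_3, ...: it lies in C(3,3)
   iff every f_{2j+1} <= 1 and every f_{2j} + f_{2j+1} + f_{2j+2} <= 2 (with
   f_0 = 0).  The even multiplicities l of a partition pi in E(3,3) satisfy
   l_j + l_{j+1} <= 2, and N_2 counts its "pairs": each multiplicity 2 and each
   two consecutive entries in a run of 1's.  Moving every pair up by one step is
   a bijection [advance] from such sequences to those with first entry <= 1; it
   adds 2 N_2 to the size of pi.

   Phi scans upwards.  If b is the even multiplicity just emitted, l the
   multiplicities still to be read and z the remaining values (zeta_i - 1) / 2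
   (relative to the current position), then z >= N_2(b :: l) throughout.  An odd
   part is emitted exactly when N_2(b :: l) = N_2(l) = min z; it then replaces
   the part 2 min z + 1 of zeta, and the excess 2 min z = 2 N_2(l) is spent on
   advancing all pairs of l.  Since [advance] is invertible, the emitted
   multiplicities and the updated data determine the previous data. *)

(** * Advancing the pairs of a multiplicity sequence *)

Definition adj (x y : nat) := x + y <= 2.

(* No trailing zero, so that each finitely supported sequence has one list. *)
Definition canonical (l : seq nat) := last 1 l != 0.
Arguments canonical : simpl never.

(** Prepending that keeps lists [canonical]: the zero sequence stays the empty list, and splitting
    into [head 0] and [behead] is undone there too. *)
Definition cons0 (x : nat) (l : seq nat) :=
  if (x == 0) && (l == [::]) then [::] else x :: l.

Fixpoint even_run (l : seq nat) :=
  if l is x :: l' then (x == 1) ==> ~~ even_run l' else true.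

(* Within a run of 1's the entries followed by an odd remaining run are counted,
   i.e. half of the run rounded down. *)
Fixpoint pairs (l : seq nat) :=
  if l is x :: l' then (1 < x) + ((x == 1) && ~~ even_run l') + pairs l' else 0.

(** Entry j, counted from 0, has coefficient j + 1: half the sum of the parts when entry j is the
    multiplicity of 2j + 2. *)
Fixpoint weight (l : seq nat) :=
  if l is x :: l' then x + weight l' + sumn l' else 0.

(* (2, 0) becomes (1, 1); a run of 1's becomes (0, 2, 0, 2, ...), preceded by an
   unmoved 1 if its length is odd. *)
Fixpoint advance (l : seq nat) : seq nat :=
  match l with
  | [::] => [::]
  | 0 :: l' => 0 :: advance l'
  | 1 :: l' => if even_run l' then 1 :: advance l'
               else 0 :: 2 :: (if l' is _ :: l'' then advance l'' else [::])
  | _ :: l' => 1 :: 1 :: (if l' is _ :: l'' then advance l'' else [::])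
  end.

(** In an advanced sequence the block 0, 2 arises only from two 1's, the block 1, 1 only from a 2
    and the 0 after it, and any other 1 is unmoved. *)
Fixpoint retreat (l : seq nat) : seq nat :=
  match l with
  | 0 :: 2 :: l' => 1 :: 1 :: retreat l'
  | 0 :: l' => 0 :: retreat l'
  | 1 :: 1 :: l' => 2 :: cons0 0 (retreat l')
  | x :: l' => x :: retreat l'
  | [::] => [::]
  end.

Lemma path_adj_weak b c l : c <= b -> path adj b l -> path adj c l.
Proof. by case: l => //= x l cb /andP[bx ->]; rewrite andbT /adj in bx *; lia. Qed.

Lemma canonical_behead x l : canonical (x :: l) -> canonical l.
Proof. by case: l. Qed.

Lemma canonical_cons x l : x != 0 -> canonical l -> canonical (x :: l).
Proof. by case: l. Qed.

Lemma canonical_cons0 x l : canonical l -> canonical (cons0 x l).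
Proof. by rewrite /cons0; case: l => [|y l]; case: x. Qed.

Lemma cons0_headK l : canonical l -> cons0 (head 0 l) (behead l) = l.
Proof. by rewrite /cons0; case: l => // x [|y l] //=; case: x. Qed.

Lemma head_cons0 x l : head 0 (cons0 x l) = x.
Proof. by rewrite /cons0; case: x => [|x]; case: l. Qed.

Lemma behead_cons0 x l : behead (cons0 x l) = l.
Proof. by rewrite /cons0; case: x => [|x]; case: l. Qed.

Lemma path_cons0 b x l : path adj b (x :: l) -> path adj b (cons0 x l).
Proof. by rewrite /cons0; case: ifP. Qed.

Lemma pairs_cons0 x l : pairs (cons0 x l) = pairs (x :: l).
Proof. by rewrite /cons0; case: ifP => // /andP[/eqP-> /eqP->]. Qed.

Lemma even_run0 l : head 0 l = 0 -> even_run l.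
Proof. by case: l => // x l /= ->. Qed.

(** The first condition of the scan for an odd part: b is 0, or it is a 1 that completes no pair
    with the run behind it. *)
Lemma pairs_cons_eq b l :
  (pairs l == pairs (b :: l)) = (b <= 1) && ((b == 1) ==> even_run l).
Proof. by case: b => [|[|b]] /=; case: (even_run l) => /=; lia. Qed.

Lemma pairs_cons_le b l : pairs l <= pairs (b :: l) <= (pairs l).+1.
Proof. by case: b => [|[|b]] /=; case: (even_run l) => /=; lia. Qed.

Lemma even_run_ones l : even_run l = false -> exists2 l', l = 1 :: l' & even_run l'.
Proof. by case: l => // -[|[|x]] //= l /negbFE; exists l. Qed.

(** Induction along the blocks that [advance] rewrites. Adjacency bounds the entries by 2 and puts a
    0 after each 2, possibly the implicit 0 past the end, hence [cons0]. *)
Lemma advance_ind (P : seq nat -> Prop) :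
  P [::] ->
  (forall l, l != [::] -> path adj 0 l -> canonical l -> P l -> P (0 :: l)) ->
  (forall l, path adj 0 l -> canonical l -> P l -> P (2 :: cons0 0 l)) ->
  (forall l, path adj 1 l -> canonical l -> even_run l -> P l -> P (1 :: l)) ->
  (forall l, path adj 1 l -> canonical l -> even_run l -> P l ->
     P (1 :: 1 :: l)) ->
  forall l, path adj 0 l -> canonical l -> P l.
Proof.
move=> P0 Pz P2 P1 P11 l; have [n] := ubnP (size l).
elim: n l => // n IHn [|x l] //= lenl /andP[x2 pl] cl.
have cl' := canonical_behead cl.
have pl0 : path adj 0 l by apply: path_adj_weak pl.
case: x x2 pl cl => [|[|[|x]]] //= _ pl cl.
- by apply: Pz => //; [case: (l) cl | apply: IHn].
- case: (boolP (even_run l)) => [el|/negbTE/even_run_ones[l' El el']].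
    by apply: P1 => //; apply: IHn.
  rewrite El /= in pl pl0 lenl cl' *.
  by apply: P11 => //; apply: IHn => //; [lia | apply: path_adj_weak pl].
- have -> : l = cons0 0 (behead l).
    by rewrite -[LHS]cons0_headK //; case: (l) pl => // -[].
  have pl' : path adj 0 (behead l).
    by case: (l) pl0 => //= y m /andP[_]; apply: path_adj_weak.
  have cl'' : canonical (behead l) by case: (l) cl' => // y m /canonical_behead.
  by apply: P2 => //; apply: IHn => //; rewrite size_behead; lia.
Qed.

Lemma advance_two l : advance (2 :: cons0 0 l) = 1 :: 1 :: advance l.
Proof. by case: l. Qed.

(** For a list allowed after a 1, the advanced list starts with 0 exactly when that 1 adds no pair;
    this makes room for an odd part. *)
Lemma head_advance l : (head 0 (advance l) == 0) = even_run l && (head 0 l <= 1).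
Proof. by case: l => // -[|[|x]] //= l; case: (even_run l); case: l => //= -[]. Qed.

Lemma advance_nil l : (advance l == [::]) = (l == [::]).
Proof. by case: l => // -[|[|x]] //= l; case: ifP. Qed.

Lemma head_advance0 l : path adj 1 l -> even_run l -> head 0 (advance l) = 0.
Proof.
move=> pl el; apply/eqP; rewrite head_advance el /=.
by case: (l) pl => //= x m /andP[]; rewrite /adj; lia.
Qed.

Lemma path_adj_head b c l : path adj c l -> b + head 0 l <= 2 -> path adj b l.
Proof. by case: l => //= x l /andP[_ ->]; rewrite andbT. Qed.

(** An unmoved 1 or a new 2 has an even run behind it, so a 0 follows after advancing; after a new
    1, 1 an entry at most 1 suffices. *)
Lemma path_advance l : path adj 0 l -> canonical l -> path adj 1 (advance l).
Proof.
move: l; apply: advance_ind => //.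
- by move=> l _ _ _ /= pl; apply: path_adj_weak pl.
- by move=> l _ _; rewrite advance_two.
- move=> l pl _ el IH /=; rewrite el /=; apply: path_adj_head IH _.
  by rewrite head_advance0.
- move=> l pl _ el IH /=; rewrite el /=; apply: path_adj_head IH _.
  by rewrite head_advance0.
Qed.

Lemma canonical_advance l : path adj 0 l -> canonical l -> canonical (advance l).
Proof.
move: l; apply: advance_ind => //.
- by move=> l l0 _ _; rewrite -advance_nil in l0; rewrite /=; case: (advance l) l0.
- by move=> l _ _ IH; rewrite advance_two; do 2!apply: canonical_cons => //.
- by move=> l pl _ el IH /=; rewrite el /=; apply: canonical_cons.
- move=> l pl _ el IH /=; rewrite el /=.
  by case: (advance l) IH.
Qed.

(** Two 1's in front of a list add exactly one pair, whatever the parity of the run behind them. *)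
Lemma pairs_advance l : path adj 0 l -> canonical l -> pairs (advance l) = pairs l.
Proof.
move: l; apply: advance_ind => //.
- move=> l _ _ IH; rewrite advance_two /= pairs_cons0 /= IH.
  by case: (even_run _) => /=; lia.
- move=> l pl _ el IH /=; rewrite el /= IH.
  by rewrite even_run0 // head_advance0.
- by move=> l pl _ el IH /=; rewrite el /= IH; lia.
Qed.

Lemma sumn_cons0 x l : sumn (cons0 x l) = x + sumn l.
Proof. by rewrite /cons0; case: ifP => // /andP[/eqP-> /eqP->]. Qed.

Lemma weight_cons0 x l : weight (cons0 x l) = x + weight l + sumn l.
Proof. by rewrite /cons0; case: ifP => // /andP[/eqP-> /eqP->]. Qed.

Lemma sumn_advance l : path adj 0 l -> canonical l -> sumn (advance l) = sumn l.
Proof.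
move: l; apply: advance_ind => //.
- by move=> l _ _ IH; rewrite advance_two /= sumn_cons0 IH; lia.
- by move=> l pl _ el IH /=; rewrite el /= IH.
- by move=> l pl _ el IH /=; rewrite el /= IH; lia.
Qed.

(** Each block 2, 0 or 1, 1 is one pair, and rewriting it moves one unit up by one position. *)
Lemma weight_advance l : path adj 0 l -> canonical l ->
  weight (advance l) = weight l + pairs l.
Proof.
move: l; apply: advance_ind => //.
- by move=> l _ pl cl IH /=; rewrite IH sumn_advance //; lia.
- move=> l pl cl IH; rewrite advance_two /= weight_cons0 pairs_cons0 sumn_cons0 IH.
  by rewrite sumn_advance //=; lia.
- move=> l pl cl el IH /=; rewrite el /= IH sumn_advance ?(path_adj_weak _ pl) //.
  by lia.
- move=> l pl cl el IH /=; rewrite el /= IH sumn_advance ?(path_adj_weak _ pl) //.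
  by lia.
Qed.

Lemma retreat_zero l : head 0 l <= 1 -> retreat (0 :: l) = 0 :: retreat l.
Proof. by case: l => // -[|[|x]]. Qed.

Lemma retreat_one l : head 0 l = 0 -> retreat (1 :: l) = 1 :: retreat l.
Proof. by case: l => // -[|[|x]]. Qed.

Lemma advanceK l : path adj 0 l -> canonical l -> retreat (advance l) = l.
Proof.
move: l; apply: advance_ind => //.
- move=> l _ pl cl IH; rewrite [advance _]/= retreat_zero ?IH //.
  by have := path_advance pl cl; case: (advance l) => //= x m /andP[].
- by move=> l pl cl IH; rewrite advance_two /= IH.
- by move=> l pl cl el IH /=; rewrite el retreat_one ?IH // head_advance0.
- by move=> l pl cl el IH /=; rewrite el /= IH.
Qed.

(** Induction along the blocks that [retreat] recognises: as the first entry is at most 1, a 2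
    occurs only after a 0. *)
Lemma retreat_ind (P : seq nat -> Prop) :
  P [::] ->
  (forall l, l != [::] -> path adj 1 l -> canonical l -> P l -> P (0 :: l)) ->
  (forall l, head 0 l = 0 -> path adj 1 l -> canonical l -> P l ->
     P (0 :: 2 :: l)) ->
  (forall l, path adj 1 l -> canonical l -> P l -> P (1 :: 1 :: l)) ->
  (forall l, head 0 l = 0 -> path adj 1 l -> canonical l -> P l ->
     P (1 :: l)) ->
  forall l, path adj 1 l -> canonical l -> P l.
Proof.
move=> P0 Pz P02 P11 P1 l; have [n] := ubnP (size l).
elim: n l => // n IHn [|x l] //= lenl /andP[x2 pl] cl.
have cl' := canonical_behead cl.
case: x x2 pl cl => [|[|x]] //= _ pl cl.
- case: l pl cl cl' lenl => [|[|[|[|y]]] l] //= pl cl cl' lenl.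
  + by apply: Pz => //; apply: IHn.
  + by apply: Pz => //; apply: IHn.
  + have pl1 : path adj 1 l by apply: path_adj_weak pl.
    apply: P02 => //.
    * by move: pl; case: (l) => //= x m /andP[]; rewrite /adj; lia.
    * exact: canonical_behead cl'.
    * by apply: IHn => //; [lia | exact: canonical_behead cl'].
- case: l pl cl cl' lenl => [|[|[|y]] l] //= pl cl cl' lenl.
  + exact: P1.
  + by apply: P1 => //; apply: IHn.
  + by apply: P11 => //; apply: IHn => //; lia.
Qed.

Lemma retreat_spec l : path adj 1 l -> canonical l ->
  [/\ path adj 0 (retreat l), canonical (retreat l) & advance (retreat l) = l].
Proof.
move: l; apply: retreat_ind => //.
- move=> l l0 pl cl [pr cr ar].
  rewrite retreat_zero; last by case: (l) pl => //= x m /andP[].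
  split; rewrite /= ?ar //.
  by case: (retreat l) cr ar => // _ ar; rewrite -ar in l0.
- move=> l hl pl cl [pr cr ar].
  (* Read backwards: [advance] of the retreated tail starts with 0, so that tail starts with an even
     run and may follow a 1. *)
  have := head_advance (retreat l); rewrite ar hl eqxx => /esym/andP[er hr].
  split; rewrite /= ?er /= ?ar //.
  by apply: path_adj_head pr _; lia.
- move=> l pl cl [pr cr ar]; split; last by rewrite advance_two ar.
    by rewrite /=; apply: path_cons0 => /=.
  by rewrite /=; apply: canonical_cons => //; apply: canonical_cons0.
- move=> l hl pl cl [pr cr ar].
  have := head_advance (retreat l); rewrite ar hl eqxx => /esym/andP[er hr].
  rewrite retreat_one //; split; rewrite /= ?er /= ?ar //.
  by apply: path_adj_head pr _; lia.
Qed.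

(** * The scan and its inverse *)

Definition state := (seq nat * seq nat)%type.

Definition odd_next b (s : state) :=
  (pairs s.1 == pairs (b :: s.1)) && (ohead s.2 == Some (pairs s.1)).

(** Moving up one position lowers every remaining odd part by 2, hence every value (zeta_i - 1) / 2
    by 1. *)
Definition step b (s : state) : nat * nat * state :=
  let l := if odd_next b s then advance s.1 else s.1 in
  let z := if odd_next b s then behead s.2 else s.2 in
  ((nat_of_bool (odd_next b s), head 0 l), (behead l, map predn z)).

(** The restored value can be read off before retreating, since [advance] preserves [pairs]. *)
Definition unstep (p : nat * nat) (s : state) : state :=
  let l := cons0 p.2 s.1 in
  let z := map succn s.2 in
  if p.1 == 0 then (l, z) else (retreat l, pairs l :: z).

Definition valid_state b (s : state) :=
  [&& path adj b s.1, canonical s.1, sorted ltn s.2 &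
      all (leq (pairs (b :: s.1))) s.2].

Definition state_size (s : state) := sumn s.1 + size s.2.

Definition state_sum (s : state) :=
  (weight s.1).*2 + sumn [seq x.*2.+1 | x <- s.2].

Lemma sorted_ltn_cons n z : sorted ltn (n :: z) = all (leq n.+1) z && sorted ltn z.
Proof. by rewrite /= path_sortedE //; apply: ltn_trans. Qed.

Lemma sorted_ltn_all n z : sorted ltn z -> all (leq n) z ->
  ohead z != Some n -> all (leq n.+1) z.
Proof.
case: z => // x z; rewrite sorted_ltn_cons => /andP[/allP xz _] /= /andP[nx _].
rewrite (inj_eq Some_inj) => nex; apply/andP; split; first by lia.
by apply/allP => y /xz /=; lia.
Qed.

(** The values are positive, so no truncation occurs in [predn]. *)
Lemma map_predn_shift n z : all (leq n.+1) z ->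
  [/\ map succn (map predn z) = z, all (leq n) (map predn z),
      sorted ltn (map predn z) = sorted ltn z &
      sumn [seq x.*2.+1 | x <- z] =
      sumn [seq x.*2.+1 | x <- map predn z] + (size z).*2].
Proof.
elim: z => // x z IH /= /andP[nx nz]; have [-> -> sz ->] := IH nz.
split; rewrite ?prednK //; try lia.
case: (z) nz sz => //= y z' /andP[ny _] ->.
by congr (_ && _); lia.
Qed.

Lemma map_succn_shift n z :
  [/\ map predn (map succn z) = z,
      all (leq n.+1) (map succn z) = all (leq n) z &
      sorted ltn (map succn z) = sorted ltn z].
Proof.
split; first by rewrite mapK.
  by rewrite all_map.
by rewrite sorted_map.
Qed.

Lemma sumn_behead l : sumn l = head 0 l + sumn (behead l).
Proof. by case: l. Qed.

Lemma weight_behead l :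
  weight l = head 0 l + weight (behead l) + sumn (behead l).
Proof. by case: l. Qed.

Lemma path_behead b l : path adj b l -> path adj (head 0 l) (behead l).
Proof. by case: l => //= x l /andP[]. Qed.

Lemma path_head b l : path adj b l -> b <= 2 -> b + head 0 l <= 2.
Proof. by case: l => //= [|x l /andP[]]; rewrite /adj //; lia. Qed.

Lemma canonical_tail l : canonical l -> canonical (behead l).
Proof. by case: l => // x l; apply: canonical_behead. Qed.

Lemma pairs_cons_head l : pairs (head 0 l :: behead l) = pairs l.
Proof. by case: l. Qed.

(** Parts are measured from the current position, so each part left in [s'] accounts for 2 in the
    sum. If an odd part is emitted, the excess 2 [pairs l] of the removed part is what
    [weight_advance] gives back. *)
Lemma step_spec b s : b <= 2 -> valid_state b s ->
  let p := (step b s).1 in let s' := (step b s).2 in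
  [/\ valid_state p.2 s', b + p.1 + p.2 <= 2, unstep p s' = s,
      state_size s = p.1 + p.2 + state_size s' &
      state_sum s = p.1 + p.2.*2 + state_sum s' + (state_size s').*2].
Proof.
case: s => l z b2 /and4P[/= pl cl sz lez]; rewrite /step /=.
have pl0 : path adj 0 l by apply: path_adj_weak pl.
case Eo: (odd_next b (l, z)) => /=; last first.
  (* Without an odd part, either b adds a pair and the invariant is already this bound, or the least
     value differs from [pairs l]. *)
  have {Eo sz lez}[sz lez] : sorted ltn z /\ all (leq (pairs l).+1) z.
    split=> //; move: Eo; rewrite /odd_next [(l, z).1]/= [(l, z).2]/=.
    case: eqP => [El /negbT|nEl _].
      by apply: sorted_ltn_all; rewrite ?El.
    suff -> : (pairs l).+1 = pairs (b :: l) by [].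
    by have := pairs_cons_le b l; lia.
  have [zK az ss sE] := map_predn_shift lez.
  split=> /=.
  - rewrite /valid_state [_.1]/= [_.2]/= pairs_cons_head ss sz az.
    by rewrite (path_behead pl) canonical_tail.
  - by rewrite addn0; apply: path_head pl b2.
  - by rewrite /unstep /= cons0_headK // zK.
  - by rewrite /state_size /= size_map sumn_behead; lia.
  - by rewrite /state_sum /state_size /= size_map weight_behead sE; lia.
move: Eo; rewrite /odd_next /= => /andP[Eb].
case: z sz lez => // n z; rewrite sorted_ltn_cons => /andP[lez sz] _ /eqP[En].
rewrite {n}En in lez *; move: Eb; rewrite pairs_cons_eq => /andP[b1 eb].
have [zK az ss sE] := map_predn_shift lez.
have pA := path_advance pl0 cl; have cA := canonical_advance pl0 cl.
have nA := pairs_advance pl0 cl; have sA := sumn_advance pl0 cl.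
have wA := weight_advance pl0 cl.
split=> /=.
- rewrite /valid_state [_.1]/= [_.2]/= pairs_cons_head ss sz nA az.
  by rewrite (path_behead pA) canonical_tail.
(* Room for the odd part: after b = 0 the advanced head is at most 1, after b = 1 it is 0. *)
- case: b b1 eb pl b2 => [|[|b]] // _ eb pl _.
    by rewrite add0n; apply: path_head pA _.
  by rewrite head_advance0.
- by rewrite /unstep /= cons0_headK // zK nA advanceK.
- by rewrite /state_size /= size_map -sA sumn_behead; lia.
- rewrite /state_sum /state_size /= size_map.
  by have := weight_behead (advance l); rewrite wA sE; lia.
Qed.

Lemma unstep_spec b a c s : a <= 1 -> b + a + c <= 2 -> valid_state c s ->
  valid_state b (unstep (a, c) s) /\ step b (unstep (a, c) s) = ((a, c), s).
Proof.
case: s => l z a1 bac /and4P[/= pl cl sz lez].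
have cl1 := canonical_cons0 c cl.
have pl1 d : d + c <= 2 -> path adj d (cons0 c l).
  by move=> dc; apply: path_cons0 => /=; rewrite pl andbT.
have [zK az ss] := map_succn_shift (pairs (c :: l)) z.
case: a a1 bac => [|[|a]] // _ bac.
  rewrite /unstep /= /valid_state /step.
  rewrite [_.1]/= [_.2]/= pl1 ?cl1 ?ss ?sz //=; last by lia.
  have lez1 : all (leq (pairs (cons0 c l)).+1) (map succn z).
    by rewrite pairs_cons0 az.
  split.
    apply/allP => x /(allP lez1) xl.
    by apply: leq_trans xl; have /andP[_] := pairs_cons_le b (cons0 c l).
  (* The shifted values all exceed [pairs (cons0 c l)], so the scan emits no odd part here. *)
  suff -> : odd_next b (cons0 c l, [seq i.+1 | i <- z]) = false.
    by rewrite /= head_cons0 behead_cons0 zK.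
  rewrite /odd_next /=; apply/negbTE/negP => /andP[_].
  case: (z) lez1 => //= x z' /andP[xl _] /eqP[xE].
  by rewrite xE ltnn in xl.
(* An emitted odd part forces c to be at most 1, which is the condition for lying in the image of
   [advance]. *)
have [pR cR aR] := retreat_spec (pl1 1 ltac:(lia)) cl1.
have nR : pairs (retreat (cons0 c l)) = pairs (cons0 c l).
  by rewrite -[in RHS]aR pairs_advance.
have Eb : pairs (retreat (cons0 c l)) == pairs (b :: retreat (cons0 c l)).
  rewrite pairs_cons_eq; apply/andP; split; first by lia.
  (* If b = 1 then c = 0, and the retreated list starts with an even run. *)
  apply/implyP => /eqP b1.
  have := head_advance (retreat (cons0 c l)); rewrite aR head_cons0.
  by rewrite (_ : c == 0) => [/esym/andP[] //|]; lia.
have Eo : odd_next b (unstep (1, c) (l, z)).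
  by rewrite /odd_next /unstep [_.1]/= [_.2]/= Eb /= nR eqxx.
split; last first.
  rewrite /step Eo /unstep /= aR head_cons0 behead_cons0 zK //.
have lez1 : all (leq (pairs (c :: l)).+1) (map succn z) by rewrite az.
rewrite /valid_state /unstep [_.1]/= [_.2]/= -(eqP Eb) nR pairs_cons0.
rewrite cR sorted_ltn_cons ss sz lez1 /= leqnn (sub_all _ lez1); last first.
  by move=> x /ltnW.
rewrite !andbT; apply: (path_adj_head pR).
move: Eb; rewrite pairs_cons_eq => /andP[b1 eb].
have := head_advance (retreat (cons0 c l)); rewrite aR head_cons0.
have := path_head pR isT.
case: (b) b1 bac => [|[|b']] // _ bac.
by rewrite (_ : c == 0) => [_ /esym/andP[_]|]; lia.
Qed.

(* The j-th letter is (f_{2j+1}, f_{2j+2}). *)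
Definition word := seq (nat * nat).

Fixpoint run K b (s : state) : word :=
  if K is K'.+1 then
    (step b s).1 :: run K' (step b s).1.2 (step b s).2
  else [::].

Fixpoint unrun (w : word) : state :=
  if w is p :: w' then unstep p (unrun w') else ([::], [::]).

Fixpoint valid_word b (w : word) :=
  if w is (a, c) :: w' then [&& a <= 1, b + a + c <= 2 & valid_word c w'] else true.

Fixpoint word_size (w : word) :=
  if w is (a, c) :: w' then a + c + word_size w' else 0.

Fixpoint word_sum (w : word) :=
  if w is (a, c) :: w' then a + c.*2 + word_sum w' + (word_size w').*2 else 0.

Lemma runS K b s :
  run K.+1 b s = (step b s).1 :: run K (step b s).1.2 (step b s).2.
Proof. by []. Qed.

Lemma size_run K b s : size (run K b s) = K.
Proof. by elim: K b s => //= K IH b s; rewrite IH. Qed.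

(** Canonicity excludes a nonempty list of zeros. *)
Lemma state_sum0 b s : valid_state b s -> state_sum s = 0 -> s = ([::], [::]).
Proof.
case: s => l [|x z] /and4P[_ /= cl _ _]; rewrite /state_sum /= => w0; last by lia.
have {}w0 : weight l = 0 by lia.
congr pair; elim: l cl w0 => // x l IH cl /= w0.
have l0 : l = [::] by apply: IH; [exact: canonical_behead cl | lia].
by move: cl; rewrite l0 /canonical /=; lia.
Qed.

Lemma state_size0 s : state_size s = 0 -> state_sum s = 0.
Proof.
case: s => l [|x z]; rewrite /state_size /state_sum /= => s0; last by lia.
suff -> : weight l = 0 by [].
have {s0} : sumn l = 0 by lia.
by elim: l => //= x l IH s0; rewrite IH; lia.
Qed.

(** A step lowers the sum by at least 2 for each part that remains, and if none remains the sum is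
    0; so K steps empty the state. *)
Lemma run_spec K b s : b <= 2 -> valid_state b s -> state_sum s <= K ->
  [/\ valid_word b (run K b s), unrun (run K b s) = s,
      word_size (run K b s) = state_size s &
      word_sum (run K b s) = state_sum s].
Proof.
elim: K b s => [|K IH] b s b2 vs sK.
  have s0 : s = ([::], [::]) by apply: (state_sum0 vs); lia.
  by rewrite s0.
rewrite runS; have := step_spec b2 vs.
have o1 : (step b s).1.1 <= 1 by rewrite leq_b1.
case: (step b s) o1 => -[a c] s' /= a1 [vs' bac us ssz ssm].
have [] := IH c s' _ vs'; first by lia.
  by have := @state_size0 s'; lia.
by move=> /= -> -> -> ->; rewrite a1 bac us ssz ssm.
Qed.

Lemma unrun_spec b w : b <= 2 -> valid_word b w ->
  [/\ valid_state b (unrun w), state_size (unrun w) = word_size w,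
      state_sum (unrun w) = word_sum w & run (size w) b (unrun w) = w].
Proof.
elim: w b => [|[a c] w IH] b // b2 vw.
have /and3P[a1 bac vw'] : [&& a <= 1, b + a + c <= 2 & valid_word c w] := vw.
have [|vs sw mw rw] := IH c _ vw'; first by lia.
have [vs' E] := unstep_spec a1 bac vs.
have := step_spec b2 vs'; rewrite E => -[_ _ _ ss sm].
by split=> //; rewrite ?[size _]/= ?runS [unrun _]/= ?E ?rw // (ss, sm) /= sw ?mw.
Qed.

(** * Partitions in C(3,3) as words of multiplicities *)

Fixpoint parts_of (w : word) : seq nat :=
  if w is (a, c) :: w' then
    [seq x.+2 | x <- parts_of w'] ++ nseq c 2 ++ nseq a 1
  else [::].

Definition word_of (K : nat) (s : seq nat) : word :=
  mkseq (fun j => (count_mem j.*2.+1 s, count_mem j.*2.+2 s)) K.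

Lemma size_parts_of w : size (parts_of w) = word_size w.
Proof.
elim: w => // -[a c] w IH /=.
by rewrite !size_cat size_map !size_nseq IH; lia.
Qed.

Lemma sumn_parts_of w : sumn (parts_of w) = word_sum w.
Proof.
elim: w => // -[a c] w IH /=.
rewrite !sumn_cat !sumn_nseq.
suff -> : sumn [seq x.+2 | x <- parts_of w] = word_sum w + (word_size w).*2.
  by lia.
rewrite -IH -size_parts_of; elim: (parts_of w) => //= x s ->; lia.
Qed.

Lemma count_parts_of w x :
  count_mem x.+1 (parts_of w) =
  if odd x then (nth (0, 0) w x./2).2 else (nth (0, 0) w x./2).1.
Proof.
elim: w x => [|[a c] w IH] x /=; first by rewrite nth_nil; case: odd.
rewrite !count_cat count_map !count_nseq /=.
case: x => [|[|x]] /=.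
- by rewrite (@eq_count _ _ pred0) ?count_pred0 ?mul0n ?mul1n.
- rewrite (@eq_count _ _ (pred1 0)) // (_ : count_mem 0 (parts_of w) = 0).
    by rewrite !mul1n mul0n addn0.
  apply/count_memPn; elim: (w) => // -[a' c'] w' IHw /=.
  rewrite !mem_cat !negb_or !mem_nseq !andbF !andbT.
  by apply/mapP => -[].
- by rewrite negbK -IH !mul0n !addn0; apply: eq_count => y /=.
Qed.

Lemma count0_parts_of w : count_mem 0 (parts_of w) = 0.
Proof.
apply/count_memPn; case: w => // -[a c] w /=.
rewrite !mem_cat !negb_or !mem_nseq !andbF !andbT.
by apply/mapP => -[].
Qed.

Lemma parts_of_partition w : is_partition (parts_of w).
Proof.
apply/andP; split; last first.
  by apply/allP => -[|//]; rewrite -has_pred1 has_count count0_parts_of.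
elim: w => // -[a c] w IH /=.
have tr : transitive geq by move=> x y z; rewrite /=; lia.
rewrite sorted_pairwise // !pairwise_cat -!sorted_pairwise //.
have sn n x : sorted geq (nseq n x).
  case: n => //= n; elim: n => //= n ->; by rewrite leqnn.
rewrite !sn sorted_map (@eq_sorted _ _ geq) // IH !andbT.
apply/andP; split; apply/allrelP => x y.
  move=> /mapP[x' _ ->]; rewrite mem_cat !mem_nseq.
  by case/orP => /andP[_ /eqP->].
by rewrite !mem_nseq => /andP[_ /eqP->] /andP[_ /eqP->].
Qed.

Lemma partition_eq s t : is_partition s -> is_partition t ->
  (forall x, count_mem x.+1 s = count_mem x.+1 t) -> s = t.
Proof.
move=> /andP[ss ps] /andP[st pt] E.
apply: (@sorted_eq _ geq) => //.
- by move=> x y z; rewrite /=; lia.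
- by move=> x y; rewrite /=; lia.
- apply/allP => -[|x] _ /=; last by rewrite E.
  have c0 u : all (fun x => 0 < x) u -> count_mem 0 u = 0.
    by move=> /allP pu; apply/count_memPn/negP => /pu.
  by rewrite !c0.
Qed.

Lemma word_ofK K s : is_partition s -> all (leq^~ K.*2) s ->
  parts_of (word_of K s) = s.
Proof.
move=> ps sK; apply: partition_eq => // [|x]; first exact: parts_of_partition.
have := odd_double_half x; rewrite count_parts_of.
case: (ltnP x./2 K) => xK.
  by rewrite nth_mkseq //=; case: odd => /= xE; rewrite -[in RHS]xE ?add0n ?add1n.
rewrite nth_default ?size_mkseq // => xE.
have /count_memPn -> : x.+1 \notin s; last by case: odd.
by apply/negP => /(allP sK); move: xE; case: odd; lia.
Qed.

(** Trailing letters (0, 0) leave no trace in the parts, hence the condition on sizes. *)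
Lemma parts_of_inj w w' : size w = size w' -> parts_of w = parts_of w' -> w = w'.
Proof.
move=> sw pw; apply: (@eq_from_nth _ (0, 0)) => // j _.
have := count_parts_of w j.*2; rewrite pw count_parts_of odd_double doubleK.
have := count_parts_of w j.*2.+1.
rewrite pw count_parts_of /= odd_double /= uphalf_double.
by case: (nth _ w j) (nth _ w' j) => a c [a' c'] /= -> ->.
Qed.

Lemma valid_wordP b w : b <= 2 ->
  valid_word b w <->
  (forall j, (nth (0, 0) w j).1 <= 1 /\
     nth 0 (b :: [seq p.2 | p <- w]) j + (nth (0, 0) w j).1 + (nth (0, 0) w j).2
       <= 2).
Proof.
elim: w b => [|[a c] w IH] b b2 /=.
  by split=> // _ [|j]; rewrite ?nth_nil /= ?nth_nil //; lia.
split=> [/and3P[a1 bac vw] [|j] //|H].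
  by apply: (IH c _).1 vw j; lia.
have [/= a1 bac] := H 0; rewrite a1 bac /=.
by apply/IH => [|j]; [lia | apply: (H j.+1)].
Qed.

(** * The gap condition as a bound on windows of three consecutive values *)

Definition gap (x z : nat) := if odd x then z + 2 <= x else z + 2 < x.

Definition gaps (s : seq nat) :=
  all (fun i => gap (nth 0 s i) (nth 0 s i.+2)) (iota 0 (size s - 2)).

Lemma gaps_cons x y z s :
  gaps [:: x, y, z & s] = gap x z && gaps [:: y, z & s].
Proof.
rewrite /gaps /= !subSS !subn0 /=; congr (_ && _).
by rewrite -[1]addn0 iotaDl all_map.
Qed.

Definition window j (s : seq nat) := count (fun x => j.*2 <= x <= j.*2.+2) s.

Lemma windowE j s : window j s =
  count_mem j.*2 s + count_mem j.*2.+1 s + count_mem j.*2.+2 s.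
Proof. by rewrite /window; elim: s => //= x s ->; lia. Qed.

Lemma window_small j x s : sorted geq (x :: s) -> x < j.*2 -> window j (x :: s) = 0.
Proof.
move=> xs xj; apply/eqP; rewrite -leqn0 leqNgt -has_count; apply/hasPn => y ys.
suff : y <= x by lia.
move: ys; rewrite inE => /orP[/eqP-> //|].
have tr : transitive geq by move=> a b c; rewrite /=; lia.
by move: xs; rewrite /= path_sortedE // => /andP[/allP xs _] /xs.
Qed.

(** A window with three parts contains three consecutive ones x, y, z of the sequence, and a window
    from 2j to 2j + 2 holds x and z only if [gap x z] fails. *)
Lemma gapsP s : sorted geq s -> (gaps s <-> forall j, window j s <= 2).
Proof.
elim: s => // x [|y [|z s]] IH xs; try by split=> // _ j; rewrite /window /=; lia.
have E j u t : window j (u :: t) = (j.*2 <= u <= j.*2.+2) + window j t by [].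
rewrite gaps_cons; have ys := path_sorted xs; have zs := path_sorted ys.
have {}IH := IH ys.
have /and3P[xy yz _] : [&& y <= x, z <= y & path geq z s] := xs; split.
  move=> /andP[xz /IH/(_ _)wj] j; have := wj j.
  rewrite (E _ x); case: (boolP (_ <= x <= _)) => // /andP[jx xj] _.
  have [yj|jy] := ltnP y j.*2; first by rewrite window_small.
  have [zj|jz] := ltnP z j.*2; first by rewrite E (window_small zs) //; lia.
  by move: xz; rewrite /gap; case: ifP; lia.
move=> H; apply/andP; split; last first.
  by apply/IH => j; apply: leq_trans (H j); rewrite [leqRHS]E leq_addl.
(* The window from x - 1 to x + 1 for odd x, from x - 2 to x for even x: a failing gap puts z, hence
   also y, in it. *)
apply/negPn/negP => xz; have := H (if odd x then x./2 else x./2.-1).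
rewrite !E; move: xz; rewrite /gap; have := odd_double_half x.
by case: odd => /=; lia.
Qed.

Lemma inC33P s : is_partition s ->
  inC33 s <-> (forall j, count_mem j.*2.+1 s <= 1) /\ (forall j, window j s <= 2).
Proof.
move=> ps; have [ss pos] := andP ps.
(* The bound on the number of parts at most 2 is the case j = 0 of the window condition. *)
have w0 : window 0 s = count (fun x => x <= 2) s by apply: eq_count.
rewrite /inC33 ps -/(gaps s) -w0 /=; split.
  move=> /and3P[/allP od /(gapsP ss) gs _]; split=> // j.
  have [js|/count_memPn -> //] := boolP (j.*2.+1 \in s).
  by have /implyP := od _ js; rewrite /= odd_double => ->.
move=> [od wn]; rewrite wn andbT; apply/andP; split; last exact/gapsP.
apply/allP => x _; apply/implyP => ox.
by have := odd_double_half x; have := od x./2; rewrite ox add1n => + xE; rewrite xE.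
Qed.

Lemma inC33_parts_of w : inC33 (parts_of w) <-> valid_word 0 w.
Proof.
rewrite valid_wordP // inC33P; last exact: parts_of_partition.
have c1 j : count_mem j.*2.+1 (parts_of w) = (nth (0, 0) w j).1.
  by rewrite count_parts_of odd_double doubleK.
have c2 j : count_mem j.*2.+2 (parts_of w) = (nth (0, 0) w j).2.
  by rewrite count_parts_of /= odd_double /= uphalf_double.
have c0 j : count_mem j.*2 (parts_of w) = nth 0 (0 :: [seq p.2 | p <- w]) j.
  case: j => [|j]; first by rewrite count0_parts_of.
  rewrite doubleS c2 /=; have [jw|wj] := ltnP j (size w).
    by rewrite (nth_map (0, 0)).
  by rewrite !nth_default // size_map.
split=> [[od wn] j|H].
  by rewrite -c0 -c1 -c2 -windowE.
by split=> j; [rewrite c1|rewrite windowE c0 c1 c2]; have [] := H j.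
Qed.

(** * Partitions into even parts, and the marks *)

Definition even_word (l : seq nat) : word := [seq (0, c) | c <- l].

Lemma valid_even_word b l : valid_word b (even_word l) = path adj b l.
Proof. by elim: l b => //= c l IH b; rewrite IH addn0. Qed.

Lemma word_size_even l : word_size (even_word l) = sumn l.
Proof. by elim: l => //= c l ->. Qed.

Lemma word_sum_even l : word_sum (even_word l) = (weight l).*2.
Proof. by elim: l => //= c l ->; rewrite word_size_even; lia. Qed.

Lemma even_parts_of l : all (fun x => ~~ odd x) (parts_of (even_word l)).
Proof.
elim: l => //= c l IH; rewrite !all_cat all_map all_nseq /= !orbT !andbT.
by apply: sub_all IH => x /=; rewrite negbK.
Qed.

Fixpoint ascending d (l : seq nat) : seq nat :=
  if l is c :: l' then nseq c d ++ ascending d.+2 l' else [::].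

Lemma rev_parts_of_even l : rev (parts_of (even_word l)) = ascending 2 l.
Proof.
elim: l => // c l IH /=; rewrite cats0 rev_cat rev_nseq -map_rev IH.
congr (_ ++ _); elim: (l) (2) => //= a l' IHl d.
by rewrite map_cat map_nseq IHl.
Qed.

Definition conflicts d (prev : seq (nat * nat)) : seq nat :=
  [seq pm.2 | pm <- prev & gg_conflict d pm.1].

Lemma conflicts_far d prev : all (fun pm => pm.1.+2 <= d) prev ->
  conflicts d.+2 prev = [::].
Proof.
rewrite /conflicts; elim: prev => //= pm prev IH /andP[pd /IH].
by rewrite /gg_conflict (_ : (d.+2 - pm.1 <= 2) = false) //; lia.
Qed.

(* Reading upwards, a part of multiplicity 1 just above a lone mark 1 gets
   mark 2, and just above a lone mark 2 it gets mark 1 again; so the marks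
   alternate 1, 2, 1, 2, ... along a run of multiplicities 1. *)
Lemma count_gg_aux d l prev : ~~ odd d ->
  all (fun pm => pm.1.+2 <= d) prev ->
  let n := count (pred1 2) (gg_aux prev (ascending d l)) in
  [/\ conflicts d prev = [::] -> path adj 0 l -> n = pairs l,
      conflicts d prev = [:: 1] -> path adj 1 l -> n = pairs (1 :: l),
      conflicts d prev = [:: 2] -> path adj 1 l -> n = pairs l &
      conflicts d prev = [:: 2; 1] -> path adj 2 l -> n = pairs l].
Proof.
elim: l d prev => [|c l IH] d prev od far //=.
have od2 : ~~ odd d.+2 by rewrite /= negbK.
have far0 := conflicts_far far.
have far2 : all (fun pm => pm.1.+2 <= d.+2) prev.
  by apply: sub_all far => pm; lia.
have dd : gg_conflict d d by rewrite /gg_conflict subnn; case: odd.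
have dd2 : gg_conflict d.+2 d.
  by rewrite /gg_conflict (negbTE od2) /= andbT; lia.
have conf1 m : conflicts d.+2 ((d, m) :: prev) = [:: m].
  by rewrite /conflicts /= dd2 /= -[map _ _]/(conflicts _ _) far0.
have conf2 m m' : conflicts d.+2 [:: (d, m), (d, m') & prev] = [:: m; m'].
  by rewrite /conflicts /= dd2 /= -[map _ _]/(conflicts _ _) far0.
have /= [IH0 _ _ _] := IH d.+2 prev od2 far2.
have IH1 m : all (fun pm => pm.1.+2 <= d.+2) ((d, m) :: prev).
  by rewrite /= leqnn far2.
have /= [_ IH11 _ _] := IH _ _ od2 (IH1 1).
have /= [_ _ IH12 _] := IH _ _ od2 (IH1 2).
have IH2 : all (fun pm => pm.1.+2 <= d.+2) [:: (d, 2), (d, 1) & prev].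
  by rewrite /= leqnn far2.
have /= [_ _ _ IH22] := IH _ _ od2 IH2.
split=> cM /andP[cb pl].
- case: c cb pl => [|[|[|c]]] //= _ pl; rewrite -?/(conflicts _ _).
  + exact: IH0.
  + by rewrite cM /= IH11.
  + by rewrite cM /= dd /= -/(conflicts _ _) cM /= IH22.
- case: c cb pl => [|[|c]] //= _ pl; rewrite -?/(conflicts _ _).
  + exact: IH0.
  (* The part gets mark 2, and two 1's in front of [l] add one pair for either parity of the run
     behind. *)
  + by rewrite cM /= IH12 //; case: even_run => /=; lia.
- case: c cb pl => [|[|c]] //= _ pl; rewrite -?/(conflicts _ _).
  + exact: IH0.
  + by rewrite cM /= IH11.
- case: c cb pl => [|c] //= _ pl; exact: IH0.
Qed.

Lemma N2_parts_of_even l : path adj 0 l -> N2 (parts_of (even_word l)) = pairs l.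
Proof.
move=> pl; rewrite /N2 /GG rev_parts_of_even.
by have [->] := @count_gg_aux 2 l [::] isT isT.
Qed.

(** For even parts the length, half the largest part, makes the last entry the multiplicity of that
    part, so the list is [canonical]. *)
Definition even_multiplicities (s : seq nat) : seq nat :=
  mkseq (fun j => count_mem j.*2.+2 s) (head 0 s)./2.

Lemma canonical_eq l l' : canonical l -> canonical l' ->
  (forall j, nth 0 l j = nth 0 l' j) -> l = l'.
Proof.
have nil m : canonical m -> (forall j, nth 0 m j = 0) -> m = [::].
  case: m => // x m; rewrite /canonical -nth_last /= => + m0.
  by rewrite (set_nth_default 0) //= m0.
elim: l l' => [|x l IH] [|x' l'] cl cl' E //.
- by apply/esym/nil => // j; rewrite -E nth_nil.
- by apply/nil => // j; rewrite E nth_nil.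
congr cons; first exact: (E 0).
apply: IH => [||j]; [exact: canonical_behead cl| |exact: (E j.+1)].
exact: canonical_behead cl'.
Qed.

Lemma partition_le_head s : is_partition s -> all (leq^~ (head 0 s)) s.
Proof.
case: s => //= x s /andP[]; rewrite /= leqnn path_sortedE => [/andP[]//|].
by move=> a b c; rewrite /=; lia.
Qed.

Lemma canonical_even_multiplicities s : is_partition s ->
  all (fun x => ~~ odd x) s -> canonical (even_multiplicities s).
Proof.
case: s => // x s /andP[_ /andP[x0 _]] /andP[ox _].
rewrite /canonical /even_multiplicities -nth_last size_mkseq [head _ _]/=.
have := odd_double_half x; rewrite (negbTE ox) add0n => xE.
have xh : 0 < x./2 by lia.
rewrite nth_mkseq ?prednK // -doubleS prednK // xE.
by rewrite -lt0n -has_count has_pred1 mem_head.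
Qed.

Lemma even_multiplicitiesK s : is_partition s -> all (fun x => ~~ odd x) s ->
  parts_of (even_word (even_multiplicities s)) = s.
Proof.
move=> ps es; rewrite -[RHS](@word_ofK (head 0 s)./2) //; last first.
  apply/allP => x xs; have := allP (partition_le_head ps) x xs.
  have := allP es x xs; have : ~~ odd (head 0 s) by case: (s) es => //= y t /andP[].
  by lia.
congr parts_of; rewrite /even_word /word_of /mkseq -map_comp; apply: eq_map => j /=.
congr (_, _); apply/esym/count_memPn/negP => /(allP es).
by rewrite /= odd_double.
Qed.

Lemma parts_of_evenK l : canonical l ->
  even_multiplicities (parts_of (even_word l)) = l.
Proof.
move=> cl; have pl := parts_of_partition (even_word l).
have el := even_parts_of l.
apply: canonical_eq => // [|j]; first exact: canonical_even_multiplicities.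
have nthE m : count_mem j.*2.+2 (parts_of (even_word m)) = nth 0 m j.
  rewrite count_parts_of /= odd_double /= uphalf_double.
  have [jm|mj] := ltnP j (size m); first by rewrite (nth_map 0).
  by rewrite !nth_default // size_map.
by rewrite -nthE even_multiplicitiesK.
Qed.

(** Reversal puts the least value first, where [odd_next] looks; for odd x, [x./2] is (x - 1) /
    2. *)
Definition encode (pi zeta : seq nat) : state :=
  (even_multiplicities pi, rev [seq x./2 | x <- zeta]).

Definition decode_odd (z : seq nat) := rev [seq x.*2.+1 | x <- z].

Lemma encode_spec pi zeta : inF33 pi zeta ->
  [/\ valid_state 0 (encode pi zeta),
      state_size (encode pi zeta) = size pi + size zeta,
      state_sum (encode pi zeta) = sumn pi + sumn zeta,
      parts_of (even_word (encode pi zeta).1) = pi &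
      decode_odd (encode pi zeta).2 = zeta].
Proof.
case/and5P => /andP[Cpi Epi] /andP[sz _] uz oz nz.
have /and4P[ppi _ _ _] := Cpi.
have piE := even_multiplicitiesK ppi Epi.
have zE : decode_odd (encode pi zeta).2 = zeta.
  rewrite /decode_odd /= map_rev revK -map_comp -[RHS]map_id.
  apply/eq_in_map => x /(allP oz) ox /=.
  by have := odd_double_half x; rewrite ox.
set l := even_multiplicities pi in piE *.
have pl : path adj 0 l by rewrite -valid_even_word; apply/inC33_parts_of; rewrite piE.
have nE : N2 pi = pairs l by rewrite -piE N2_parts_of_even.
split=> //.
- rewrite /valid_state /= -/l pl canonical_even_multiplicities //=.
  rewrite rev_sorted all_rev all_map; apply/andP; split; last first.
    (* With b = 0 in the role of f_0, the invariant asks exactly for values at least N_2(pi). *)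
    by apply: sub_all nz => x /=; rewrite nE; lia.
  rewrite sorted_map.
  have sz' : sorted gtn zeta by rewrite gtn_sorted_uniq_geq uz.
  by apply: (sub_in_sorted _ oz sz') => x y; rewrite -!topredE /=; lia.
- rewrite /state_size /= -word_size_even -size_parts_of piE.
  by rewrite size_rev size_map.
- rewrite /state_sum -word_sum_even -sumn_parts_of piE; congr (_ + _).
  by rewrite -[in RHS]zE /decode_odd sumn_rev.
Qed.

Lemma decode_spec s : valid_state 0 s ->
  let pi := parts_of (even_word s.1) in let zeta := decode_odd s.2 in
  inF33 pi zeta /\ encode pi zeta = s.
Proof.
case: s => l z /and4P[/= pl cl sz nz]; split; last first.
  rewrite /encode parts_of_evenK // /decode_odd map_rev revK -map_comp.
  by congr pair; rewrite -[RHS]map_id; apply: eq_map => x /=; rewrite uphalf_double.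
have oz : sorted ltn [seq x.*2.+1 | x <- z].
  by rewrite sorted_map; apply: sub_sorted sz => x y /=; lia.
apply/and5P; split.
- rewrite /inE33 even_parts_of andbT; apply/inC33_parts_of.
  by rewrite valid_even_word.
- rewrite /is_partition /decode_odd rev_sorted all_rev all_map.
  apply/andP; split; last by apply/allP.
  by apply: sub_sorted oz => x y /=; lia.
- by rewrite /decode_odd rev_uniq; apply: sorted_uniq oz; [exact: ltn_trans|exact: ltnn].
- by rewrite /decode_odd all_rev all_map; apply/allP => x _ /=; rewrite odd_double.
- rewrite N2_parts_of_even // /decode_odd all_rev all_map.
  by apply: sub_all nz => x /=; lia.
Qed.

Theorem theorem5p1 :
  exists Phi : seq nat -> seq nat -> seq nat,
    [/\ (forall pi zeta, inF33 pi zeta ->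
           [/\ inC33 (Phi pi zeta),
               sumn (Phi pi zeta) = sumn pi + sumn zeta &
               size (Phi pi zeta) = size pi + size zeta]),
        (forall pi zeta pi' zeta', inF33 pi zeta -> inF33 pi' zeta' ->
           Phi pi zeta = Phi pi' zeta' -> pi = pi' /\ zeta = zeta') &
        (forall omega, inC33 omega ->
           exists pi zeta, inF33 pi zeta /\ Phi pi zeta = omega)].
Proof.
(* The number of steps is the sum of the image, so pairs with equal images give words of equal
   size. *)
pose w pi zeta := run (sumn pi + sumn zeta) 0 (encode pi zeta).
have wP pi zeta : inF33 pi zeta ->
    [/\ inC33 (parts_of (w pi zeta)), unrun (w pi zeta) = encode pi zeta,
        sumn (parts_of (w pi zeta)) = sumn pi + sumn zeta &
        size (parts_of (w pi zeta)) = size pi + size zeta].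
  move=> /encode_spec[vs ss sm _ _].
  have [||vw uw sw smw] := @run_spec (sumn pi + sumn zeta) 0 _ _ vs => //.
    by rewrite sm.
  split=> //; first exact/inC33_parts_of.
    by rewrite sumn_parts_of smw.
  by rewrite size_parts_of sw.
exists (fun pi zeta => parts_of (w pi zeta)); split.
- by move=> pi zeta /wP[].
- move=> pi zeta pi' zeta' F F' E.
  have [_ uw sw _] := wP _ _ F; have [_ uw' sw' _] := wP _ _ F'.
  have [_ _ _ piE zE] := encode_spec F; have [_ _ _ piE' zE'] := encode_spec F'.
  have wE : w pi zeta = w pi' zeta'.
    by apply: parts_of_inj => //; rewrite !size_run -sw -sw' E.
  have eE : encode pi zeta = encode pi' zeta' by rewrite -uw wE.
  by split; [rewrite -piE eE|rewrite -zE eE].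
- move=> om Com; have /and4P[pom _ _ _] := Com.
  (* No part exceeds the sum, so this many letters cover all parts. *)
  have omE : parts_of (word_of (sumn om) om) = om.
    apply: word_ofK => //; apply/allP => x; elim: (om) => //= y t IH.
    by rewrite inE => /orP[/eqP->|/IH]; lia.
  have vw : valid_word 0 (word_of (sumn om) om).
    by apply/inC33_parts_of; rewrite omE.
  have Kw : size (word_of (sumn om) om) = sumn om by rewrite size_mkseq.
  have [vs _ smw rE] := @unrun_spec 0 _ isT vw.
  have /= [F eE] := decode_spec vs.
  do 2!eexists; split; first exact: F.
  have [_ _ sm _ _] := encode_spec F.
  (* The scan of the decoded pair takes as many steps as the word has letters, so [rE] returns that
     word. *)
  rewrite /w -sm eE smw -sumn_parts_of omE -[X in run X]Kw.
  by rewrite rE omE.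
Qed.
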